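(* Let $\Sigma$ be a finite alphabet, $h:\Sigma^*\to M$ a monoid morphism into a finite monoid, and $L\subseteq\Sigma^*$. Suppose the set $\mathcal P$ of relative primes is finite, $L$ is $h$-substitutable, and FRP fails. Then there are relative primes $P,A$ and a live relative class $R\subseteq A\backslash P$, together with infinitely many pairwise distinct valid productions $P\to A\alpha_n$ ($n\in\mathbb N$, $\alpha_n\in\mathcal P^+$), such that $[\overline{\alpha_n}]=R$ and $\overline{\alpha_n}\subsetneq R$ for all $n$. The lengths $|\alpha_n|$ are unbounded along a subsequence.
   Context: $D_L(x)=\{(u,v):uxv\in L\}$; $x\equiv_L y$ iff $D_L(x)=D_L(y)$. $L$ is $h$-substitutable if for all $x,y\in\Sigma^*$, $h(x)=h(y)$ and $D_L(x)\cap D_L(y)\ne\varnothing$ imply $x\equiv_L y$. The relative syntactic congruence $\theta$ is: $x\,\theta\,y$ iff $x\equiv_L y$ and $h(x)=h(y)$; its classes $[x]$ are called relative classes. A relative class is live if $D_L(x)\neq\varnothing$ for its members. The unit class is $[\varepsilon]$. For relative classes: $X\cdot Y=\{xy:x\in X,y\in Y\}$, $X*Y=[xy]$ for any $x\in X,y\in Y$, and $A\backslash P=\{x\in\Sigma^*:Ax\subseteq P\}$. A relative prime is a live relative class $P\ne[\varepsilon]$ such that whenever $P=X\cdot Y$ (equality of sets) for relative classes $X,Y$, one of $X,Y$ is $[\varepsilon]$. For a nonempty prime sequence $\alpha=P_1\cdots P_k$ put $\overline\alpha=P_1\cdot\ldots\cdot P_k\subseteq\Sigma^*$ and $[\overline\alpha]=P_1*\cdots*P_k$.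 For $P\in\mathcal P$ and $\alpha\in\mathcal P^*$ with $|\alpha|\ge2$, the production $P\to\alpha$ is correct if $[\overline\alpha]=P$; $\alpha$ is pleonastic if some proper contiguous block $\beta$ of $\alpha$ with $|\beta|\ge2$ has $[\overline\beta]\in\mathcal P$; a correct production is valid if its right-hand side is not pleonastic. FRP (finite relative presentation property): $\mathcal P$ is finite and the set of valid productions is finite. *)

(* Defs.v *)
From mathcomp Require Import all_boot.
From mathcomp Require Import boolp classical_sets cardinality.

Set Implicit Arguments.
Unset Strict Implicit.
Unset Printing Implicit Defensive.

Local Open Scope classical_set_scope.

Definition word_morphism (Sigma : finType) (M : monoidType)
    (h : seq Sigma -> M) : Prop :=
  h [::] = 1%g /\ forall x y, h (x ++ y) = (h x * h y)%g.

Definition lcat (Sigma : finType) (X Y : set (seq Sigma)) : set (seq Sigma) :=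
  [set x ++ y | x in X & y in Y].

(* the language [overline alpha]; the empty sequence gives {epsilon} *)
Definition lprod (Sigma : finType) (alpha : seq (set (seq Sigma)))
    : set (seq Sigma) :=
  foldr (@lcat Sigma) [set [::]] alpha.

(* the quotient A \ P *)
Definition lquot (Sigma : finType) (A P : set (seq Sigma)) : set (seq Sigma) :=
  [set x | lcat A [set x] `<=` P].

Definition dist (Sigma : finType) (L : set (seq Sigma)) (x : seq Sigma)
    : set (seq Sigma * seq Sigma) :=
  [set c | L (c.1 ++ x ++ c.2)].

Definition syn_equiv (Sigma : finType) (L : set (seq Sigma))
    (x y : seq Sigma) : Prop :=
  dist L x = dist L y.

Section RelativeClasses.

Variables (Sigma : finType) (M : monoidType) (L : set (seq Sigma))
  (h : seq Sigma -> M).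

Definition substitutable : Prop :=
  forall x y, h x = h y -> dist L x `&` dist L y !=set0 -> syn_equiv L x y.

Definition theta (x y : seq Sigma) : Prop := syn_equiv L x y /\ h x = h y.

Definition rclass (x : seq Sigma) : set (seq Sigma) := [set y | theta x y].

Definition unit_class : set (seq Sigma) := rclass [::].

Definition relative_class (X : set (seq Sigma)) : Prop :=
  exists x, X = rclass x.

Definition live (X : set (seq Sigma)) : Prop :=
  forall x, X x -> dist L x !=set0.

(* X * Y, written without choosing representatives: the union of all [xy].
   See rmul_rclass. *)
Definition rmul (X Y : set (seq Sigma)) : set (seq Sigma) :=
  [set w | exists x y, [/\ X x, Y y & rclass (x ++ y) w]].

(* P_1 * ... * P_k; the trailing unit class is neutral on relative classes,
   see rmul_unit. *)
Definition rprod (alpha : seq (set (seq Sigma))) : set (seq Sigma) :=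
  foldr rmul unit_class alpha.

Definition relative_prime (P : set (seq Sigma)) : Prop :=
  [/\ relative_class P, live P, P <> unit_class &
      forall X Y, relative_class X -> relative_class Y ->
        P = lcat X Y -> X = unit_class \/ Y = unit_class].

Definition primes_of : set (set (seq Sigma)) := [set P | relative_prime P].

Definition prime_seq (alpha : seq (set (seq Sigma))) : Prop :=
  forall P, P \in alpha -> relative_prime P.

(* the pair (P, alpha) stands for the production P -> alpha *)
Definition production : Type := set (seq Sigma) * seq (set (seq Sigma)).

Definition correct (p : production) : Prop :=
  [/\ relative_prime p.1, prime_seq p.2, (2 <= size p.2)%N
    & rprod p.2 = p.1].

Definition pleonastic (alpha : seq (set (seq Sigma))) : Prop :=
  exists a1 beta a2,
    [/\ alpha = a1 ++ beta ++ a2, beta <> alpha, (2 <= size beta)%N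
      & relative_prime (rprod beta)].

Definition valid (p : production) : Prop := correct p /\ ~ pleonastic p.2.

Definition FRP : Prop :=
  finite_set primes_of /\ finite_set [set p : production | valid p].

Hypothesis hM : word_morphism h.

Lemma theta_cat x x' y y' :
  theta x x' -> theta y y' -> theta (x ++ y) (x' ++ y').
Proof.
move=> [Dx hx] [Dy hy]; split; last by rewrite !hM.2 hx hy.
rewrite /syn_equiv; apply/seteqP; split=> -[u v]; rewrite /dist /= => Luv.
- have : dist L x (u, y ++ v) by rewrite /dist /= -?catA in Luv *.
  rewrite Dx /dist /= catA => H.
  have : dist L y (u ++ x', v) by [].
  by rewrite Dy /dist /= -!catA.
- have : dist L x' (u, y' ++ v) by rewrite /dist /= -?catA in Luv *.
  rewrite -Dx /dist /= catA => H.
  have : dist L y' (u ++ x, v) by [].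
  by rewrite -Dy /dist /= -!catA.
Qed.

Lemma rmul_rclass x y : rmul (rclass x) (rclass y) = rclass (x ++ y).
Proof.
apply/seteqP; split=> w.
- move=> [x' [y' [xx' yy' [Dw hw]]]].
  have [D h'] := theta_cat xx' yy'.
  by split; [rewrite /syn_equiv D | rewrite h'].
- by move=> xyw; exists x, y; split.
Qed.

Lemma rmul_unit X : relative_class X -> rmul X unit_class = X.
Proof. by move=> [x ->]; rewrite rmul_rclass cats0. Qed.

End RelativeClasses.

(* Main.v *)
(* By substitutability, for fixed P and A the relative class R of a sequence
   alpha with P -> A alpha correct is determined by its image in the finite
   monoid M: two words of R, R' with equal image share a context obtained from
   a context of P.  Primes do not contain the empty word, so a factorization
   R = lprod alpha has at most as many factors as the shortest word of R has
   letters.  Hence, if for every P, A, R the sequences alpha with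
   P -> A alpha valid, rprod alpha = R and lprod alpha <> R had bounded
   length, all valid productions would have
   bounded length, and there would be finitely many of them. *)

Require Import Defs.
From mathcomp Require Import all_boot.
From mathcomp Require Import boolp classical_sets cardinality.

Local Open Scope classical_set_scope.

Set Implicit Arguments.
Unset Strict Implicit.
Unset Printing Implicit Defensive.

(** Choose a bound for each point; by monotonicity the maximum over the finite set [D] serves all
    its points. *)
Lemma finite_uniform_bound (T : Type) (D : set T) (Q : T -> nat -> Prop) :
  finite_set D -> (forall x, exists N, Q x N) ->
  (forall x m n, (m <= n)%N -> Q x m -> Q x n) ->
  exists N, forall x, D x -> Q x N.
Proof.
move=> finD exQ monoQ; have [f fQ] := choice exQ.
have /finite_seqP[s Es] : finite_set (f @` D) by exact: finite_image.
exists (\max_(k <- s) k)%N => x Dx; apply: monoQ (fQ x).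
apply: (@leq_bigmax_seq _ s xpredT id) => //.
by have : (f @` D) (f x) by [exists x]; rewrite Es.
Qed.

Lemma finite_bounded_seqs (T : eqType) (D : set T) (n : nat) :
  finite_set D ->
  finite_set [set s : seq T | (forall x, x \in s -> D x) /\ (size s <= n)%N].
Proof.
move=> finD; elim: n => [|n IHn].
  by apply: (sub_finite_set _ (finite_set1 [::])) => s [_]; case: s.
set S := [set s | _] in IHn.
apply: (@sub_finite_set _ _
  ([set [::]] `|` (fun p => p.1 :: p.2) @` (D `*` S))).
  move=> [|x s] [Ds sz]; [by left | right; exists (x, s) => //].
  split=> /=; first by apply: Ds; rewrite mem_head.
  by split=> // y ys; apply: Ds; rewrite inE ys orbT.
rewrite finite_setU; split; first exact: finite_set1.
by apply: finite_image; exact: finite_setX.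
Qed.

(** Strict growth of lengths later yields both distinctness and unboundedness of the tails. *)
Lemma unbounded_increasing (T : Type) (S : set (seq T)) :
  (forall n, exists2 s, S s & (n <= size s)%N) ->
  exists a : nat -> seq T,
    (forall n, S (a n)) /\ forall n, (size (a n) < size (a n.+1))%N.
Proof.
move=> exS.
have /choice[f fP] : forall n, exists s, S s /\ (n <= size s)%N.
  by move=> n; have [s ? ?] := exS n; exists s.
(* Each term is chosen to be at least one longer than its predecessor. *)
exists (fun n => iter n (fun s => f (size s).+1) (f 0)); split.
  by case=> [|n] /=; exact: (fP _).1.
by move=> n; exact: (fP _).2.
Qed.

Section Productions.

Variables (Sigma : finType) (M : monoidType) (L : set (seq Sigma))
  (h : seq Sigma -> M).
Hypothesis h_morphism : word_morphism h.

Implicit Types (P A R X : set (seq Sigma)) (alpha : seq (set (seq Sigma))).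

Lemma rclass_eq x y : theta L h x y -> rclass L h x = rclass L h y.
Proof.
move=> [Dxy hxy]; apply/seteqP; split=> z [Dz hz]; split.
- by rewrite /syn_equiv -Dxy.
- by rewrite -hxy.
- by rewrite /syn_equiv Dxy.
- by rewrite hxy.
Qed.

Lemma relative_class_mem X x :
  relative_class L h X -> X x -> X = rclass L h x.
Proof. by move=> [y ->] /rclass_eq. Qed.

Lemma rprod_class alpha :
  prime_seq L h alpha -> relative_class L h (rprod L h alpha).
Proof.
elim: alpha => [|P alpha IH] prA; first by exists [::].
have [x Ex] : relative_class L h (rprod L h alpha).
  by apply: IH => Q Qa; apply: prA; rewrite inE Qa orbT.
have [[p ->] _ _ _] := prA P (mem_head _ _).
by exists (p ++ x); rewrite /= Ex rmul_rclass.
Qed.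

Lemma lprod_sub_rprod alpha : lprod alpha `<=` rprod L h alpha.
Proof.
elim: alpha => [|P alpha IH] w /=; first by move=> ->.
by move=> [x Px [y ay <-]]; exists x, y; split=> //; exact: IH.
Qed.

Lemma prime_nil P : relative_prime L h P -> ~ P [::].
Proof. by move=> [cP _ neP _] /(relative_class_mem cP). Qed.

(** Every factor of [w] lies in a prime, hence is nonempty and contributes at least one letter. *)
Lemma size_lprod alpha w :
  prime_seq L h alpha -> lprod alpha w -> (size alpha <= size w)%N.
Proof.
elim: alpha w => [//|P alpha IH] w prA [x Px [y ay <-]].
have le_ay : (size alpha <= size y)%N.
  by apply: IH => // Q Qa; apply: prA; rewrite inE Qa orbT.
rewrite size_cat /= -add1n leq_add //.
by case: x Px => // /(prime_nil (prA P (mem_head _ _))).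
Qed.

Lemma rmul_sub_lquot P A R : rmul L h A R = P -> R `<=` lquot A P.
Proof. by move=> <- x Rx w [a Aa [_ -> <-]]; exists a, x; split. Qed.

(** A context [(u, v)] of [a ++ x] becomes the context [(u ++ a, v)] of [x]. *)
Lemma rmul_live P A R :
  (exists a, A a) -> live L P -> rmul L h A R = P -> live L R.
Proof.
move=> [a Aa] liveP EP x Rx.
have /liveP[[u v] /= Luv] : P (a ++ x) by rewrite -EP; exists a, x.
by exists (u ++ a, v); move: Luv; rewrite /dist /= -!catA.
Qed.

Lemma valid_cons P A alpha : valid L h (P, A :: alpha) ->
  [/\ relative_prime L h P, relative_prime L h A, prime_seq L h alpha,
      alpha <> [::] & rmul L h A (rprod L h alpha) = P].
Proof.
move=> [[/= prP prs sz E] _]; split=> //.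
- exact: prs (mem_head _ _).
- by move=> Q Qa; apply: prs; rewrite inE Qa orbT.
- by move=> a0; rewrite a0 in sz.
Qed.

Hypothesis L_substitutable : substitutable L h.

Lemma right_factor_unique P A R R' x x' :
  (exists a, A a) -> live L P -> relative_class L h P ->
  relative_class L h R -> relative_class L h R' ->
  rmul L h A R = P -> rmul L h A R' = P -> R x -> R' x' -> h x = h x' ->
  R = R'.
Proof.
move=> [a Aa] liveP cP cR cR' EP EP' Rx R'x' hxx'.
have Pax : P (a ++ x) by rewrite -EP; exists a, x.
have Pax' : P (a ++ x') by rewrite -EP'; exists a, x'.
have [[u v] Dax] := liveP _ Pax.
(* Both [a ++ x] and [a ++ x'] lie in the single class [P], so they have the same contexts. *)
have Dax' : dist L (a ++ x') (u, v).
  have [<- _] : theta L h (a ++ x) (a ++ x'); last exact: Dax.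
  by move: Pax'; rewrite (relative_class_mem cP Pax).
have Dxx' : syn_equiv L x x'.
  apply: L_substitutable => //; exists (u ++ a, v).
  by move: Dax Dax'; rewrite /dist /= -!catA.
rewrite (relative_class_mem cR Rx) (relative_class_mem cR' R'x').
exact: rclass_eq.
Qed.

(** Since [lprod alpha] is always contained in [rprod alpha], the inequality here amounts to proper
    inclusion in [R]. *)
Definition strict_tails P A R : set (seq (set (seq Sigma))) :=
  [set alpha | [/\ valid L h (P, A :: alpha), rprod L h alpha = R
                 & lprod alpha <> R]].

(** A tail that is not strict has [lprod alpha = R], so any fixed word of [R] bounds its length. *)
Lemma bounded_tails_of_class P A R N :
  (forall alpha, strict_tails P A R alpha -> (size alpha <= N)%N) ->
  exists N', forall alpha, valid L h (P, A :: alpha) ->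
    rprod L h alpha = R -> (size alpha <= N')%N.
Proof.
move=> bN; have [[w Rw]|noR] := pselect (exists w, R w).
  exists (maxn N (size w)) => alpha va Ea; rewrite leq_max.
  have [_ _ pra _ _] := valid_cons va.
  have [EaR|neR] := pselect (lprod alpha = R).
    by rewrite (size_lprod pra) ?orbT // EaR.
  by rewrite bN.
(* For empty [R] there is no tail at all, because [rprod alpha] is a relative class and so
   nonempty. *)
exists 0 => alpha va Ea; case: noR.
have [_ _ pra _ _] := valid_cons va.
have [w Ew] := rprod_class pra.
by exists w; rewrite -Ea Ew.
Qed.

Lemma FRP_of_bounded_tails :
  finite_set [set: M] -> finite_set (primes_of L h) ->
  (forall P A R, exists N, forall alpha,
     strict_tails P A R alpha -> (size alpha <= N)%N) ->
  FRP L h.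
Proof.
move=> finM finP bnd; split=> //.
have fin3 : finite_set (primes_of L h `*` primes_of L h `*` [set: M]).
  by do 2 apply: finite_setX => //.
(* Tails are indexed by an image in [M] instead of by the class [R], so that only finitely many
   triples occur. *)
pose Q (t : set (seq Sigma) * set (seq Sigma) * M) N :=
  forall alpha w, valid L h (t.1.1, t.1.2 :: alpha) ->
    rprod L h alpha w -> h w = t.2 -> (size alpha <= N)%N.
have [|t m n mn Qm|N NP] := @finite_uniform_bound _ _ Q fin3.
- move=> [[P A] m].
  (* One witness [alpha0] fixes the class: by [right_factor_unique] every other tail of this triple
     has the same [rprod]. Without a witness the bound is vacuous. *)
  have [[alpha0 [w0 [v0 aw0 hw0]]]|none] := pselect (exists alpha w,
      [/\ valid L h (P, A :: alpha), rprod L h alpha w & h w = m]).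
    have [N0 bN0] := bnd P A (rprod L h alpha0).
    have [N bN] := bounded_tails_of_class bN0.
    exists N => alpha w /= va aw hw; apply: bN => //.
    have [[cP liveP _ _] [[a EA] _ _ _] pra _ E] := valid_cons va.
    have [_ _ pra0 _ E0] := valid_cons v0.
    apply: (@right_factor_unique P A _ _ w w0); rewrite ?hw ?hw0 //.
    + by exists a; rewrite EA.
    + exact: rprod_class.
    + exact: rprod_class.
  by exists 0 => alpha w /= va aw hw; case: none; exists alpha, w.
- by move=> alpha w va aw hw; exact: leq_trans (Qm _ _ va aw hw) mn.
(* The successor accounts for the head [A] in front of the tail. *)
apply: sub_finite_set (finite_setX finP (finite_bounded_seqs N.+1 finP)).
move=> [P [|A alpha]] va; first by case: va => -[].
have [prP prA pra _ _] := valid_cons va.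
have [w Ew] := rprod_class pra.
split=> //=; split; last first.
  by apply: (NP (P, A, h w) _ alpha w) => //=; rewrite Ew.
by case: va => -[].
Qed.

End Productions.

Theorem theorem11p4 (Sigma : finType) (M : monoidType)
    (M_finite : finite_set [set: M])
    (h : seq Sigma -> M) (h_morphism : word_morphism h)
    (L : set (seq Sigma))
    (primes_finite : finite_set (primes_of L h))
    (L_substitutable : substitutable L h)
    (not_FRP : ~ FRP L h) :
  exists (P A R : set (seq Sigma)) (alpha : nat -> seq (set (seq Sigma))),
    [/\ relative_prime L h P /\ relative_prime L h A,
        [/\ relative_class L h R, live L R & R `<=` lquot A P],
        forall n, alpha n <> [::] /\ prime_seq L h (alpha n),
        injective (fun n => (P, A :: alpha n)) /\
          (forall n, valid L h (P, A :: alpha n))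
      & (forall n, rprod L h (alpha n) = R /\ lprod (alpha n) `<` R) /\
        (exists phi : nat -> nat,
           (forall m n, (m < n)%N -> (phi m < phi n)%N) /\
           (forall B, exists N, forall n, (N <= n)%N ->
              (B <= size (alpha (phi n)))%N))].
Proof.
have [P [A [R unbd]]] : exists P A R, forall n,
    exists2 alpha, strict_tails L h P A R alpha & (n <= size alpha)%N.
  apply: contrapT => none; apply: not_FRP.
  apply: FRP_of_bounded_tails => // P A R; apply: contrapT => nobound.
  apply: none; exists P, A, R => n; apply: contrapT => noalpha.
  apply: nobound; exists n => alpha Sa; rewrite leqNgt; apply/negP => lt_n.
  by apply: noalpha; exists alpha => //; exact: ltnW.
have [alpha [Sa incr]] := unbounded_increasing unbd.
have lt_size m n : (m < n)%N -> (size (alpha m) < size (alpha n))%N.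
  by apply: (homo_ltn ltn_trans (f := fun k => size (alpha k))).
have [va0 Ea0 _] := Sa 0.
(* The single production with tail [alpha 0] already gives all the properties of [P], [A] and
   [R]. *)
have [prP prA pra0 _ E0] := valid_cons va0; rewrite Ea0 in E0.
have [[a EA] _ _ _] := prA; have [_ liveP _ _] := prP.
exists P, A, R, alpha; split=> //.
- split; first by rewrite -Ea0; exact: rprod_class.
  + by apply: rmul_live liveP E0; exists a; rewrite EA.
  + exact: rmul_sub_lquot E0.
- by move=> n; have [/valid_cons[]] := Sa n.
- split=> [m n [] Emn|n]; last by have [] := Sa n.
  by case: (ltngtP m n) => // /lt_size; rewrite Emn ltnn.
- split=> [n|].
    have [_ Ea ne] := Sa n; split=> //; rewrite properEneq.
    split; first exact/eqP.
    by rewrite -Ea; exact: lprod_sub_rprod.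
  (* No thinning out is required: strict growth gives [n <= size (alpha n)]. *)
  exists id; split=> // B; exists B => n le_Bn; apply: leq_trans le_Bn _.
  by elim: n => // n IH; exact: leq_ltn_trans IH (incr n).
Qed.
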